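(* Let $R$ be a field, $A$ a commutative $R$-algebra with identity $1_A$ and without zero divisors, and $f$ an averaging operator on $A$. For $a\in A$ let $ad_f(a):A\to A$ be the $R$-linear map $ad_f(a)(x)=[a,x]_f=af(x)-xf(a)$. For each $0\neq a\in A$: (i) if $\ker(f)=0$, then $0$ is the unique eigenvalue of $ad_f(a)$, and $V_0^{ad_f(a)}=A$; (ii) if $\ker(f)\neq0$ and $f(a)\neq k1_A$ for any $0\neq k\in R$, then $ad_f(a)$ has no nonzero eigenvalues; (iii) if $\ker(f)\neq0$ and $f(a)=k1_A$ for some $0\neq k\in R$, then $r=-k$ is the unique nonzero eigenvalue of $ad_f(a)$, and $V_r^{ad_f(a)}=\ker(f)$. Hence $ad_f(a)$ has at most two eigenvalues.
   Context: An averaging operator on $A$ is an $R$-linear map $f:A\to A$ with $f(xf(y))=f(x)f(y)$ for all $x,y\in A$. For an $R$-linear map $g:A\to A$ and an eigenvalue $k\in R$ of $g$, $V_k^g=\{x\in A:g(x)=kx\}$ denotes the eigenspace of $k$. *)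

(* Defs.v *)
From HB Require Import structures.
From mathcomp Require Import all_boot all_algebra.

Set Implicit Arguments.
Unset Strict Implicit.
Unset Printing Implicit Defensive.

Import GRing.Theory.
Local Open Scope ring_scope.

Definition averaging (R : fieldType) (A : comAlgType R) (f : {linear A -> A}) :=
  forall x y : A, f (x * f y) = f x * f y.

Definition kernel (R : fieldType) (A : lmodType R) (g : {linear A -> A}) :
  {pred A} := [pred x | g x == 0].

(* mathcomp's [eigenspace]/[eigenvalue] and [leigenspace]/[leigenvalue] only
   cover matrices and finite-dimensional spaces; [A] is arbitrary here. *)
Definition eigen_space (R : fieldType) (A : lmodType R) (g : {linear A -> A})
  (k : R) : {pred A} := [pred x | g x == k *: x].

Definition is_eigenvalue (R : fieldType) (A : lmodType R) (g : {linear A -> A})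
  (k : R) : Prop := exists2 x : A, x != 0 & x \in eigen_space g k.

Definition ad (R : fieldType) (A : comAlgType R) (f : {linear A -> A})
  (a x : A) : A := a * f x - x * f a.

Fact ad_is_linear (R : fieldType) (A : comAlgType R) (f : {linear A -> A})
  (a : A) : linear (ad f a).
Proof.
move=> k x y; rewrite /ad linearP mulrDr mulrDl scalerBr opprD.
by rewrite -scalerAr -scalerAl addrACA.
Qed.

HB.instance Definition _ (R : fieldType) (A : comAlgType R)
    (f : {linear A -> A}) (a : A) :=
  GRing.isLinear.Build R A A *:%R (ad f a) (ad_is_linear f a).

(* Main.v *)
(** In a commutative algebra, [f (a f(x) - x f(a)) = f a f x - f x f a = 0], so
    the image of [ad f a] lies in the kernel of [f].  If the kernel is trivial,
    [ad f a] is zero.  In general, an eigenvector [x] for [r != 0] satisfies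
    [f x = 0], so the eigenvalue equation reads [- x f(a) = r x], and
    cancelling [x] gives [f a = - r 1]. *)
Require Import Defs.
From HB Require Import structures.
From mathcomp Require Import all_boot all_algebra.
From Stdlib Require Import Classical_Prop.

Import GRing.Theory.
Local Open Scope ring_scope.

Section AveragingAd.

Set Implicit Arguments.
Unset Strict Implicit.

Variables (R : fieldType) (A : comAlgType R) (f : {linear A -> A}).
Hypothesis f_avg : averaging f.

Lemma averaging_ad (a x : A) : f (ad f a x) = 0.
Proof. by rewrite /ad linearB /= !f_avg mulrC subrr. Qed.

(** Applying [f] to [ad f a x = r *: x] kills the left side and leaves [r *: f x = 0]. *)
Lemma eigen_ad_kernel (a x : A) (r : R) :
  r != 0 -> x \in eigen_space (ad f a) r -> f x = 0.
Proof.
move=> r_neq0; rewrite inE => /eqP /= adx.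
have /eqP := averaging_ad a x.
by rewrite adx linearZ /= scaler_eq0 (negPf r_neq0) => /eqP.
Qed.

Lemma ad_kernel (a x : A) : f x = 0 -> ad f a x = - (x * f a).
Proof. by move=> fx0; rewrite /ad fx0 mulr0 sub0r. Qed.

Lemma eigenvalue_ad_neq0 (a : A) (r : R) : GRing.integral_domain_axiom A ->
  r != 0 -> is_eigenvalue (ad f a) r -> f a = (- r)%:A.
Proof.
move=> A_domain r_neq0 [x x_neq0 xr].
have fx0 := eigen_ad_kernel r_neq0 xr.
move: xr; rewrite inE /= (ad_kernel a fx0) => /eqP xfa.
have /A_domain : x * (f a - (- r)%:A) = 0.
  by rewrite mulrBr -scalerAr mulr1 scaleNr opprK -xfa subrr.
by rewrite (negPf x_neq0) /= subr_eq0 => /eqP.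
Qed.

(** Excluded middle turns the negated equality into an actual nonzero kernel vector. *)
Lemma kernel_neq0 : ~ (kernel f =i pred1 0) -> exists2 x, x != 0 & f x = 0.
Proof.
move=> kerf; apply: NNPP => nex; apply: kerf => x; rewrite !inE.
apply/eqP/eqP => [fx0|->]; last exact: linear0.
by apply/eqP/negPn/negP => x_neq0; apply: nex; exists x.
Qed.

End AveragingAd.

Theorem proposition5p6 (R : fieldType) (A : comAlgType R)
  (A_domain : GRing.integral_domain_axiom A)
  (f : {linear A -> A}) (f_avg : averaging f) (a : A) (a_neq0 : a != 0) :
  [/\ (kernel f =i pred1 0 ->
        unique (is_eigenvalue (ad f a)) 0
        /\ eigen_space (ad f a) 0 =i predT),
      (~ (kernel f =i pred1 0) ->
        (forall k : R, k != 0 -> f a <> k%:A) ->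
        forall r : R, r != 0 -> ~ is_eigenvalue (ad f a) r),
      (~ (kernel f =i pred1 0) ->
        forall k : R, k != 0 -> f a = k%:A ->
        unique (fun r : R => r != 0 /\ is_eigenvalue (ad f a) r) (- k)
        /\ eigen_space (ad f a) (- k) =i kernel f)
    &
      forall s : seq R, uniq s ->
        (forall r : R, r \in s -> is_eigenvalue (ad f a) r) ->
        (size s <= 2)%N].
Proof.
(* Both eigenvalues are determined by [f a], since the map from [R] to [A] sending [k] to [k%:A] is
   a ring morphism out of a field, hence injective. *)
have nz_inj (r r' : R) : r != 0 -> r' != 0 -> is_eigenvalue (ad f a) r ->
    is_eigenvalue (ad f a) r' -> r = r'.
  move=> r_neq0 r'_neq0 /(eigenvalue_ad_neq0 f_avg A_domain r_neq0) far.
  move=> /(eigenvalue_ad_neq0 f_avg A_domain r'_neq0); rewrite far.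
  by move/(fmorph_inj (in_alg A))/oppr_inj.
split.
- move=> kerf0.
  have ad0 x : ad f a x = 0.
    have := kerf0 (ad f a x); rewrite !inE averaging_ad // eqxx.
    by move/esym/eqP.
  split; last by move=> x; rewrite !inE /= ad0 scale0r eqxx.
  (* The map is zero, so any nonzero vector is an eigenvector; [a] is one at hand. *)
  split; first by exists a; rewrite // inE /= ad0 scale0r.
  move=> r [x x_neq0]; rewrite inE /= ad0 eq_sym scaler_eq0 (negPf x_neq0).
  by rewrite orbF => /eqP.
- move=> _ fa r r_neq0 /(eigenvalue_ad_neq0 f_avg A_domain r_neq0).
  by apply: fa; rewrite oppr_eq0.
- move=> /kernel_neq0 [x x_neq0 fx0] k k_neq0 fa.
  have Nk_neq0 : - k != 0 by rewrite oppr_eq0.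
  (* On the kernel of [f], [ad f a] is multiplication by [- f a], which is the scalar [- k]. *)
  have eigenE : eigen_space (ad f a) (- k) =i kernel f.
    move=> y; apply/idP/idP => [/(eigen_ad_kernel f_avg Nk_neq0) fy0|].
      by rewrite inE fy0.
    rewrite inE => /eqP fy0.
    by rewrite inE /= ad_kernel // fa -scalerAr mulr1 scaleNr.
  have eigNk : is_eigenvalue (ad f a) (- k).
    by exists x; rewrite // eigenE inE fx0.
  by split=> //; split=> // r [r_neq0 eigr]; exact: nz_inj.
- move=> s s_uniq s_eig.
  (* Once 0 is removed, only nonzero eigenvalues remain; two of them would coincide by [nz_inj],
     against uniqueness of the entries. *)
  have : (size (rem 0%R s) <= 1)%N.
    have rem_uniq0 := rem_uniq 0 s_uniq.
    have rem_eig r : r \in rem 0 s -> r != 0 /\ is_eigenvalue (ad f a) r.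
      by rewrite mem_rem_uniq // inE => /andP[? /s_eig].
    case: (rem 0 s) rem_uniq0 rem_eig => [|r [|r' t]] //= + eig.
    have [r_neq0 eigr] := eig r (mem_head _ _).
    have [|r'_neq0 eigr'] := eig r'; first by rewrite !inE eqxx orbT.
    by rewrite (nz_inj r r') // inE eqxx.
  (* Removing 0 shortens [s] by one if 0 occurs and leaves [s] unchanged otherwise. *)
  have [/size_rem ->|/rem_id ->] := boolP (0 \in s); last exact: leqW.
  by case: (size s).
Qed.
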